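(* Let $\epsilon,\lambda,\tau,h,d_1,d_2>0$, and let $(u_{\boldsymbol j}^n,v_{\boldsymbol j}^n,p_{\boldsymbol j}^n)$ be a solution of the first-order fully discrete semi-implicit scheme with Dirichlet boundary conditions described in the context. Let $C_u,C_v\ge 0$ be constants. Assume that the discrete initial data satisfy $0\le u_{\boldsymbol j}^0\le C_u$, $0\le v_{\boldsymbol j}^0\le C_v$ and $0\le p_{\boldsymbol j}^0\le 1$ for all ${\boldsymbol j}$, and that the discrete Dirichlet boundary data satisfy $0\le u_{\partial\Omega}(t_n)\le C_u$ and $0\le v_{\partial\Omega}(t_n)\le C_v$ for $n=1,2,\dots$. Then, for all $n$ and all ${\boldsymbol j}$, $$0\le u_{\boldsymbol j}^n\le C_u,\qquad 0\le v_{\boldsymbol j}^n\le C_v,\qquad 0\le p_{\boldsymbol j}^n\le 1 .$$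
   Context: Let $\Omega=[a,b]^d$ with $b>a$, $N$ a positive integer, $h=(b-a)/N$, time step $\tau>0$, $t_n=n\tau$. Grid nodes are $x_{\boldsymbol j}=(a+j_1h,\dots,a+j_dh)$ with multi-index ${\boldsymbol j}=(j_1,\dots,j_d)$, $j_i\in\{0,\dots,N\}$. A node is on the boundary ($x_{\boldsymbol j}\in\partial\Omega$) if $j_i\in\{0,N\}$ for some $i$, and interior otherwise. $\Delta_h$ is the standard second-order central difference Laplacian, $\Delta_h u_{\boldsymbol j}=h^{-2}\sum_{m=1}^d(u_{{\boldsymbol j}+{\boldsymbol e}_m}-2u_{\boldsymbol j}+u_{{\boldsymbol j}-{\boldsymbol e}_m})$, with ${\boldsymbol e}_m$ the $m$-th unit vector. The fully discrete scheme, for $n=0,1,2,\dots$, is $$\left[1+\tfrac{\tau}{\epsilon}(u_{\boldsymbol j}^n+v_{\boldsymbol j}^n)\right]p_{\boldsymbol j}^{n+1}=p_{\boldsymbol j}^n+\tfrac{\tau}{\epsilon}u_{\boldsymbol j}^n\quad\text{(all nodes } {\boldsymbol j}),$$ $$\left[1+\tfrac{\tau}{\epsilon}\left(v_{\boldsymbol j}^n+\lambda(1-p_{\boldsymbol j}^{n+1})\right)-d_1\tau\Delta_h\right]u_{\boldsymbol j}^{n+1}=u_{\boldsymbol j}^n\quad\text{(interior nodes)},$$ $$\left[1+\tfrac{\tau}{\epsilon}\left(u_{\boldsymbol j}^{n+1}+\lambda p_{\boldsymbol j}^{n+1}\right)-d_2\tau\Delta_h\right]v_{\boldsymbol j}^{n+1}=v_{\boldsymbol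 j}^n\quad\text{(interior nodes)},$$ with given initial values $u_{\boldsymbol j}^0,v_{\boldsymbol j}^0,p_{\boldsymbol j}^0$ at all nodes and Dirichlet conditions $u_{\boldsymbol j}^n=u_{\partial\Omega}(t_n)$, $v_{\boldsymbol j}^n=v_{\partial\Omega}(t_n)$ for $x_{\boldsymbol j}\in\partial\Omega$, $n\ge1$, where $u_{\partial\Omega},v_{\partial\Omega}$ are given functions of time. It discretizes the system $\partial_t u-d_1\Delta u=-\frac1\epsilon u[v+\lambda(1-p)]$, $\partial_t v-d_2\Delta v=-\frac1\epsilon v(u+\lambda p)$, $\partial_t p=\frac1\epsilon[(1-p)u-vp]$. *)

(* Defs.v *)
From HB Require Import structures.
From mathcomp Require Import all_boot all_order all_algebra.
From mathcomp Require Import reals.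

Set Implicit Arguments.
Unset Strict Implicit.
Unset Printing Implicit Defensive.

Import Order.TTheory GRing.Theory Num.Theory.
Local Open Scope ring_scope.

(* The node x_j = (a + j_1 h, ..., a + j_d h) is represented by j. *)
Definition multi_index (d N : nat) := {ffun 'I_d -> 'I_N.+1}.

Definition boundary_node (d N : nat) (j : multi_index d N) : bool :=
  [exists i, (nat_of_ord (j i) == 0%N) || (nat_of_ord (j i) == N)].

Definition interior_node (d N : nat) (j : multi_index d N) : bool := ~~ boundary_node j.

(* j + e_m and j - e_m. These are the intended neighbours when 0 < j_m < N,
   which covers all interior nodes; otherwise the values are junk. *)
Definition shift_up (d N : nat) (j : multi_index d N) (m : 'I_d) :
  multi_index d N := [ffun i => if i == m then inord (j i).+1 else j i].

Definition shift_down (d N : nat) (j : multi_index d N) (m : 'I_d) :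
  multi_index d N := [ffun i => if i == m then inord (j i).-1 else j i].

Definition mesh_size (R : realType) (a b : R) (N : nat) : R := (b - a) / N%:R.

Definition time (R : realType) (tau : R) (n : nat) : R := n%:R * tau.

Definition laplacian (R : realType) (d N : nat) (h : R)
    (w : multi_index d N -> R) (j : multi_index d N) : R :=
  h ^- 2 * \sum_(m < d) (w (shift_up j m) - 2 * w j + w (shift_down j m)).

Record scheme_solution (R : realType) (d N : nat)
    (h tau eps lambda d1 d2 : R) (ubd vbd : R -> R)
    (u v p : nat -> multi_index d N -> R) : Prop := SchemeSolution {
  scheme_p : forall n j,
    (1 + tau / eps * (u n j + v n j)) * p n.+1 j = p n j + tau / eps * u n j;
  scheme_u : forall n j, interior_node j ->
    (1 + tau / eps * (v n j + lambda * (1 - p n.+1 j))) * u n.+1 j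
      - d1 * tau * laplacian h (u n.+1) j = u n j;
  scheme_v : forall n j, interior_node j ->
    (1 + tau / eps * (u n.+1 j + lambda * p n.+1 j)) * v n.+1 j
      - d2 * tau * laplacian h (v n.+1) j = v n j;
  dirichlet_u : forall n j, (1 <= n)%N -> boundary_node j ->
    u n j = ubd (time tau n);
  dirichlet_v : forall n j, (1 <= n)%N -> boundary_node j ->
    v n j = vbd (time tau n)
}.

(* Main.v *)
Require Import Defs.
From HB Require Import structures.
From mathcomp Require Import all_boot all_order all_algebra.
From mathcomp Require Import reals.
From mathcomp Require Import ring lra.

Set Implicit Arguments.
Unset Strict Implicit.
Unset Printing Implicit Defensive.

Import Order.TTheory GRing.Theory Num.Theory.
Local Open Scope ring_scope.

(** Each time step solves, one after the other, a pointwise affine equation for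
    [p] and two linear elliptic problems for [u] and [v], of the form
    [(1 + c) w - k Delta_h w = f] with [c >= 0] and [k >= 0]. The semi-implicit
    splitting is chosen so that all the reaction terms sit in [c], where only
    their sign matters, and so the bounds follow by induction on time.

    The new [p] is a convex combination of the old [p], [1] and [0], with weights
    proportional to [1], [tau / eps * u] and [tau / eps * v]; this is where the
    sign of the old [u] and [v] enters. Once [0 <= p <= 1], the coefficient
    [c] of the [u]-equation, [tau / eps * (v + lambda * (1 - p))], is nonnegative;
    once the new [u] is nonnegative as well, so is the coefficient
    [tau / eps * (u + lambda * p)] of the [v]-equation.

    The elliptic problems obey a discrete maximum principle
    ([elliptic_upper_bound], [elliptic_lower_bound]): at a node where [w] is
    maximal, [Delta_h w <= 0], hence [(1 + c) w <= f <= C] there, which is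
    incompatible with [w > C >= 0]; if the maximum is on the boundary, the
    Dirichlet data bound it. The lower bound is the same principle for [- w]. *)

Lemma laplacianN (R : realType) (d N : nat) (h : R)
    (w : multi_index d N -> R) (j : multi_index d N) :
  laplacian h (fun i => - w i) j = - laplacian h w j.
Proof.
rewrite /laplacian -[RHS]mulrN -sumrN; congr (_ * _).
by apply: eq_bigr => m _; ring.
Qed.

(** The maximum is taken over all multi-indices, so the values that the shifts
    take when they would leave the grid are also dominated by [w j]. *)
Lemma laplacian_le0_at_max (R : realType) (d N : nat) (h : R)
    (w : multi_index d N -> R) (j : multi_index d N) :
  (forall i, w i <= w j) -> laplacian h w j <= 0.
Proof.
move=> w_max; rewrite /laplacian mulr_ge0_le0 ?invr_ge0 ?sqr_ge0 //.
apply: sumr_le0 => m _.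
have := w_max (shift_up j m); have := w_max (shift_down j m); lra.
Qed.

(** Discrete maximum principle. The assumption [0 <= C] makes the zeroth-order
    term [c * w] work in favour of the bound: it is nonnegative wherever [w]
    exceeds [C]. *)
Lemma elliptic_upper_bound (R : realType) (d N : nat) (h k C : R)
    (c w : multi_index d N -> R) :
  0 <= C -> 0 <= k ->
  (forall j, interior_node j -> 0 <= c j) ->
  (forall j, interior_node j -> (1 + c j) * w j - k * laplacian h w j <= C) ->
  (forall j, boundary_node j -> w j <= C) ->
  forall j, w j <= C.
Proof.
move=> C_ge0 k_ge0 c_ge0 w_sub w_bd j0.
have [j _ w_max] := @arg_maxP _ _ _ j0 predT w isT.
apply: le_trans (w_max j0 isT) _.
have [j_bd|j_int] := boolP (boundary_node j); first exact: w_bd.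
have lap_le0 : k * laplacian h w j <= 0.
  by rewrite mulr_ge0_le0 // laplacian_le0_at_max // => i; apply: w_max.
rewrite leNgt; apply/negP => w_gtC.
have cw_ge0 : 0 <= c j * w j.
  by rewrite mulr_ge0 ?c_ge0 // ltW // (le_lt_trans C_ge0).
have := w_sub j j_int; lra.
Qed.

(** The maximum principle for [- w] with the bound [0]. *)
Lemma elliptic_lower_bound (R : realType) (d N : nat) (h k : R)
    (c w : multi_index d N -> R) :
  0 <= k ->
  (forall j, interior_node j -> 0 <= c j) ->
  (forall j, interior_node j -> 0 <= (1 + c j) * w j - k * laplacian h w j) ->
  (forall j, boundary_node j -> 0 <= w j) ->
  forall j, 0 <= w j.
Proof.
move=> k_ge0 c_ge0 w_super w_bd j; rewrite -oppr_le0.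
apply: (@elliptic_upper_bound _ _ _ h k 0 c (fun i => - w i)) => // i i_node.
  by rewrite laplacianN !mulrN -opprD oppr_le0 w_super.
by rewrite oppr_le0 w_bd.
Qed.

Lemma elliptic_bounds (R : realType) (d N : nat) (h k C : R)
    (c w f : multi_index d N -> R) :
  0 <= C -> 0 <= k ->
  (forall j, interior_node j -> 0 <= c j) ->
  (forall j, interior_node j -> (1 + c j) * w j - k * laplacian h w j = f j) ->
  (forall j, interior_node j -> 0 <= f j <= C) ->
  (forall j, boundary_node j -> 0 <= w j <= C) ->
  forall j, 0 <= w j <= C.
Proof.
move=> C_ge0 k_ge0 c_ge0 w_eq f_bound w_bd j; apply/andP; split.
  apply: (@elliptic_lower_bound _ _ _ h k c) => // i i_node.
    by rewrite w_eq //; case/andP: (f_bound i i_node).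
  by case/andP: (w_bd i i_node).
apply: (@elliptic_upper_bound _ _ _ h k C c) => // i i_node.
  by rewrite w_eq //; case/andP: (f_bound i i_node).
by case/andP: (w_bd i i_node).
Qed.

(** The value [q] is the average of [p], [1] and [0] with weights [1], [x]
    and [y]. *)
Lemma weighted_average_in01 (R : realType) (x y p q : R) :
  0 <= x -> 0 <= y -> 0 <= p <= 1 ->
  (1 + (x + y)) * q = p + x -> 0 <= q <= 1.
Proof.
move=> x_ge0 y_ge0 /andP[p_ge0 p_le1] q_eq.
have weight_gt0 : 0 < 1 + (x + y) by lra.
rewrite -(pmulr_rge0 _ weight_gt0) -[q <= 1](ler_pM2l weight_gt0) q_eq mulr1.
by apply/andP; split; lra.
Qed.

Theorem theorem2p1 (R : realType) (d N : nat) (a b : R)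
    (tau eps lambda d1 d2 : R) (ubd vbd : R -> R)
    (u v p : nat -> multi_index d N -> R) (Cu Cv : R)
    (d_gt0 : (0 < d)%N) (N_gt0 : (0 < N)%N) (lt_ab : a < b)
    (tau_gt0 : 0 < tau) (eps_gt0 : 0 < eps) (lambda_gt0 : 0 < lambda)
    (d1_gt0 : 0 < d1) (d2_gt0 : 0 < d2) (Cu_ge0 : 0 <= Cu) (Cv_ge0 : 0 <= Cv)
    (sol : scheme_solution (mesh_size a b N) tau eps lambda d1 d2 ubd vbd u v p)
    (u_init : forall j, 0 <= u 0%N j <= Cu)
    (v_init : forall j, 0 <= v 0%N j <= Cv)
    (p_init : forall j, 0 <= p 0%N j <= 1)
    (ubd_bound : forall n, (1 <= n)%N -> 0 <= ubd (time tau n) <= Cu)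
    (vbd_bound : forall n, (1 <= n)%N -> 0 <= vbd (time tau n) <= Cv) :
  forall (n : nat) (j : multi_index d N),
    [/\ 0 <= u n j <= Cu, 0 <= v n j <= Cv & 0 <= p n j <= 1].
Proof.
have a_ge0 : 0 <= tau / eps by rewrite divr_ge0 // ltW.
elim=> [|n IHn] j; first by split.
have u_bound i : 0 <= u n i <= Cu by case: (IHn i).
have v_bound i : 0 <= v n i <= Cv by case: (IHn i).
have u_ge0 i : 0 <= u n i by case/andP: (u_bound i).
have v_ge0 i : 0 <= v n i by case/andP: (v_bound i).
have p_next i : 0 <= p n.+1 i <= 1.
  have [_ _ p_bound] := IHn i.
  apply: (@weighted_average_in01 _ (tau / eps * u n i) (tau / eps * v n i)
            (p n i)) => //; try exact: mulr_ge0.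
  by rewrite -mulrDr (scheme_p sol).
have u_next i : 0 <= u n.+1 i <= Cu.
  apply: (elliptic_bounds Cu_ge0 _ _ (scheme_u sol n)) => [|k _|//|k k_bd].
  - by rewrite mulr_ge0 // ltW.
  - have /andP[_ p_le1] := p_next k.
    by rewrite mulr_ge0 // addr_ge0 // mulr_ge0 ?subr_ge0 // ltW.
  - by rewrite (dirichlet_u sol) // ubd_bound.
have v_next i : 0 <= v n.+1 i <= Cv.
  apply: (elliptic_bounds Cv_ge0 _ _ (scheme_v sol n)) => [|k _|//|k k_bd].
  - by rewrite mulr_ge0 // ltW.
  - have /andP[p_ge0 _] := p_next k; have /andP[uS_ge0 _] := u_next k.
    by rewrite mulr_ge0 // addr_ge0 // mulr_ge0 // ltW.
  - by rewrite (dirichlet_v sol) // vbd_bound.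
by split.
Qed.
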